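(* Let $p\in[1,\infty[$, let $(\Omega,\mathcal F,\mathbb P)$ be an atomless probability space, and let $\rho:L^p(\Omega,\mathcal F,\mathbb P)\to\mathbb R$ be convex, nondecreasing with respect to the $\mathbb P$-almost sure partial order, and law-invariant. Let $f:\mathbb R^n\times\mathbb R^s\to\mathbb R$ be Borel-measurable and limited by an exponent $\gamma\in]0,\infty[$, and let $D_f$ denote the set of discontinuity points of $f$. Let $\mathcal M\subseteq\mathcal M_1^{\|\cdot\|^{\gamma p}}(\mathbb R^s)$ be a locally uniformly $\|\cdot\|^{\gamma p}$-integrating subset and let $(x,\nu)\in\mathbb R^n\times\mathcal M$ be such that $(\delta_x\otimes\nu)(D_f)=0$. Then the restriction $Q|_{\mathbb R^n\times\mathcal M}$ of the function $Q(x,\nu)=\mathcal R_\rho\big((\delta_x\otimes\nu)\circ f^{-1}\big)$ is continuous at $(x,\nu)$ with respect to the product topology of the standard topology on $\mathbb R^n$ and the topology of weak convergence on $\mathcal M$.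
   Context: Atomless means that $(\Omega,\mathcal F,\mathbb P)$ supports a random variable $U$ uniformly distributed on $]0,1[$. $\rho$ is law-invariant if $\rho(Y)=\rho(\widetilde Y)$ whenever $Y,\widetilde Y\in L^p(\Omega,\mathcal F,\mathbb P)$ have the same law under $\mathbb P$. $\|\cdot\|$ is the Euclidean norm. A mapping $e:\mathbb R^n\times\mathbb R^s\to\mathbb R$ is limited by the exponent $\gamma\in]0,\infty[$ if there is a locally bounded mapping $\eta:\mathbb R^n\to]0,\infty[$ with $|e(x,z)|\le\eta(x)(\|z\|^\gamma+1)$ for all $(x,z)\in\mathbb R^n\times\mathbb R^s$. For $q>0$, $\mathcal M_1^{\|\cdot\|^q}(\mathbb R^d)$ is the set of Borel probability measures $\mu$ on $\mathbb R^d$ with $\int\|z\|^q\,\mu(dz)<\infty$ (for $d=1$ written $\mathcal M_1^{|\cdot|^q}(\mathbb R)$). A subset $\mathcal M\subseteq\mathcal M_1^{\|\cdot\|^q}(\mathbb R^d)$ is locally uniformly $\|\cdot\|^q$-integrating if for every $\varepsilon>0$ and every $\nu\in\mathcal M$ there is an open neighborhood $\mathcal L$ of $\nu$ with respect to the topology of weak convergence such that $\lim_{a\to\infty}\sup_{\mu\in\mathcal L\cap\mathcal M}\int_{\mathbb R^d}\|z\|^q\,\mathbf 1_{]a,\infty[}(\|z\|^q)\,\mu(dz)\le\varepsilon$. $\mathcal R_\rho:\mathcal M_1^{|\cdot|^p}(\mathbb R)\to\mathbb R$ is defined by $\mathcal R_\rho(\mu)=\rho(F_\mu^{\leftarrow}(U))$,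 where $F_\mu^{\leftarrow}$ is the left-continuous quantile function of the distribution function of $\mu$. $\delta_x$ is the Dirac measure at $x$ and $(\delta_x\otimes\nu)\circ f^{-1}$ is the image measure under $f$. Under the growth assumption on $f$, $(\delta_x\otimes\nu)\circ f^{-1}\in\mathcal M_1^{|\cdot|^p}(\mathbb R)$ for all $x\in\mathbb R^n$, $\nu\in\mathcal M_1^{\|\cdot\|^{\gamma p}}(\mathbb R^s)$, so $Q$ is a well-defined real-valued function on $\mathbb R^n\times\mathcal M_1^{\|\cdot\|^{\gamma p}}(\mathbb R^s)$. *)

(* Defs.v *)
From HB Require Import structures.
From mathcomp Require Import all_boot all_order all_algebra.
From mathcomp Require Import all_classical all_reals all_analysis.
From mathcomp Require Import measurable_realfun.

Set Implicit Arguments.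
Unset Strict Implicit.
Unset Printing Implicit Defensive.

Import Order.TTheory GRing.Theory Num.Theory.
Import numFieldNormedType.Exports.

Local Open Scope classical_set_scope.
Local Open Scope ring_scope.

Notation borel T := (g_sigma_algebraType (@open T)).

(* The library norm on ['rV[R]_n] is the sup norm. *)
Definition enorm (R : realType) (n : nat) (v : 'rV[R]_n) : R :=
  Num.sqrt (\sum_(i < n) v ord0 i ^+ 2).

Definition limited_by (R : realType) (n s : nat) (gamma : R)
    (e : 'rV[R]_n * 'rV[R]_s -> R) : Prop :=
  exists eta : 'rV[R]_n -> R,
    [/\ [locally [bounded eta x | x in setT]],
        forall x, 0 < eta x &
        forall x z, `|e (x, z)| <= eta x * (enorm z `^ gamma + 1)].

Definition discontinuity_set (T U : topologicalType) (f : T -> U) : set T :=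
  [set z | ~ {for z, continuous f}].

Definition moment_set d (T : measurableType d) (R : realType)
    (N : T -> R) (q : R) : set (probability T R) :=
  [set mu | (\int[mu]_z (N z `^ q)%:E < +oo)%E].

Lemma open_borel_prod (R : realType) n s (A : set ('rV[R]_n * 'rV[R]_s)) :
  open A -> @measurable _ (borel 'rV[R]_n * borel 'rV[R]_s)%type A.
Proof.
move=> oA.
pose I := ('rV[rat]_n * 'rV[rat]_s * nat)%type.
pose B (i : I) : set ('rV[R]_n * 'rV[R]_s) :=
  ball (map_mx ratr i.1.1 : 'rV[R]_n) (i.2.+1%:R^-1) `*`
  ball (map_mx ratr i.1.2 : 'rV[R]_s) (i.2.+1%:R^-1).
pose C (i : I) := if `[< B i `<=` A >] then B i else set0.
have approx m (v : 'rV[R]_m) (e : R) : 0 < e ->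
    exists q : 'rV[rat]_m, ball (map_mx ratr q : 'rV[R]_m) e v.
  move=> e0.
  have /choice[q hq] (j : 'I_m) : exists q : rat, `|ratr q - v ord0 j| < e.
    have [|q] := @rat_in_itvoo R (v ord0 j - e) (v ord0 j + e).
      by rewrite ltrBlDr -addrA ltrDl addr_gt0.
    by rewrite in_itv/= -ltr_distl => ?; exists q.
  exists (\row_j q j); split => // i j.
  by rewrite ord1 !mxE; exact: hq.
have -> : A = \bigcup_i C i.
  apply/seteqP; split=> [[v w] Avw|z [i _]]; last first.
    by rewrite /C; case: asboolP => // + Bz; apply.
  have /nbhs_ballP[e /= e0 eA] : nbhs (v, w) A by exact: open_nbhs_nbhs.
  have [|k] := @ltr_add_invr R 0 (e / 2); first by rewrite divr_gt0.
  rewrite add0r => ke.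
  have k0 : 0 < k.+1%:R^-1 :> R by rewrite invr_gt0.
  have [q1 q1v] := approx _ v _ k0; have [q2 q2w] := approx _ w _ k0.
  exists (q1, q2, k) => //; rewrite /C; case: asboolP => // -[].
  move=> [v' w'] [/= q1v' q2w']; apply: eA; split => /=.
    apply: (@le_ball _ _ _ (k.+1%:R^-1 + k.+1%:R^-1)).
      by rewrite [leRHS]splitr lerD// ltW.
    by apply: ball_triangle q1v'; exact: ball_sym.
  apply: (@le_ball _ _ _ (k.+1%:R^-1 + k.+1%:R^-1)).
    by rewrite [leRHS]splitr lerD// ltW.
  by apply: ball_triangle q2w'; exact: ball_sym.
apply: countable_bigcupT_measurable => [|i]; first exact: countableP.
rewrite /C; case: asboolP => // _; apply: measurableX;
  by apply: sub_sigma_algebra; exact: ball_open.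
Qed.

Definition to_borel_prod (R : realType) n s
    (z : borel 'rV[R]_n * borel 'rV[R]_s) : borel ('rV[R]_n * 'rV[R]_s)%type :=
  z.

Lemma measurable_to_borel_prod (R : realType) n s :
  measurable_fun setT (@to_borel_prod R n s).
Proof.
apply: measurability => [//|_ [B oB <-]].
by rewrite setTI; exact: open_borel_prod.
Qed.

HB.instance Definition _ (R : realType) n s :=
  isMeasurableFun.Build _ _ _ _ _ (@measurable_to_borel_prod R n s).

Definition uniform01 d (T : measurableType d) (R : realType)
    (P : probability T R) (U : {RV P >-> R}) : Prop :=
  forall B : set R, measurable B ->
    distribution P U B = uniform_prob (@ltr01 R) B.

(* Left-continuous quantile function; only its values on ]0, 1[ matter, the
   infimum being a default value outside of it when it does not exist. *)
Definition quantile (R : realType) (mu : probability R R) (alpha : R) : R :=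
  inf [set t | (alpha%:E <= mu `]-oo, t]%classic)%E].

Lemma quantile_le (R : realType) (mu : probability R R) (alpha t : R) :
  0 < alpha < 1 -> (quantile mu alpha <= t) = (alpha%:E <= mu `]-oo, t]%classic)%E.
Proof.
move=> /andP[a0 a1].
pose X : {RV mu >-> R} :=
  mfun_Sub (mem_set (@measurable_id _ R setT)).
pose F := cdf X.
have FE u : mu `]-oo, u]%classic = F u by [].
have Fmono := cdf_nondecreasing X.
have S0 : [set t | (alpha%:E <= mu `]-oo, t]%classic)%E] !=set0.
  have /(_ [set y | (alpha%:E < y)%E]) := @cvg_cdfy1 _ _ _ mu X.
  case.
    by apply: open_nbhs_nbhs; split; [exact: open_ereal_gt_ereal|rewrite /= lte_fin].
  move=> M [_ HM]; exists (M + 1); rewrite /= FE ltW//.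
  by apply: HM; rewrite ltrDl.
have Slb : has_lbound [set t | (alpha%:E <= mu `]-oo, t]%classic)%E].
  have /(_ [set y | (y < alpha%:E)%E]) := @cvg_cdfNy0 _ _ _ mu X.
  case.
    by apply: open_nbhs_nbhs; split; [exact: open_ereal_lt_ereal|rewrite /= lte_fin].
  move=> M [_ HM]; exists M => u /= au; rewrite leNgt; apply/negP => uM.
  by have := HM _ uM; rewrite /= ltNge => /negP; apply; exact: au.
apply/idP/idP => [qt|]; last by move=> at_; exact: ge_inf.
rewrite leNgt; apply/negP => Fta.
have := @cdf_right_continuous _ _ _ mu X t.
move=> /(_ [set y | (y < alpha%:E)%E]) [].
  by apply: open_nbhs_nbhs; split; [exact: open_ereal_lt_ereal|rewrite /= -/F -FE].
move=> e /= e0 He.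
suff : t + e / 2 <= quantile mu alpha.
  by move=> /le_trans/(_ qt); rewrite leNgt ltrDl divr_gt0.
apply: lb_le_inf => // u /= au; rewrite leNgt; apply/negP => ut.
have : (F (t + e / 2)%R < alpha%:E)%E.
  apply: He => /=; last by rewrite ltrDl divr_gt0.
  by rewrite opprD addNKr normrN gtr0_norm ?divr_gt0// ltr_pdivrMr// ltr_pMr// ltr1n.
by rewrite ltNge (le_trans au)// FE; exact/Fmono/ltW.
Qed.

Lemma measurable_quantile (R : realType) (mu : probability R R) :
  measurable_fun [set: R] (quantile mu).
Proof.
have q01 : measurable_fun (`]0, 1[%classic : set R) (quantile mu).
  apply: (measurability (@RGenInftyO.G R)) => [|/= _ [_] [r] -> <-].
    exact: RGenInftyO.measurableE.
  apply: is_interval_measurable => a b /= [a01 qa] [b01 qb] c /andP[ac cb].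
  have c01 : c \in `]0, 1[.
    move: a01 b01; rewrite !in_itv/= => /andP[a0 _] /andP[_ b1].
    by rewrite (lt_le_trans a0)//= (le_lt_trans cb).
  split => //; move: qb; rewrite !in_itv/=; apply: le_lt_trans.
  move: b01 c01; rewrite !in_itv/= => b01 c01.
  by rewrite quantile_le// (@le_trans _ _ b%:E)// -quantile_le.
have -> : [set: R] = `]0, 1[%classic `|`
    (`]-oo, 0]%classic `|` (`]1, +oo[%classic `|` [set 1])).
  apply/seteqP; split => // x _; rewrite /= !in_itv/= andbT.
  have [x0|x0] := leP x 0; first by right; left.
  by have [x1|x1|->] := ltgtP x 1; [left|right; right; left|right; right; right].
apply/measurable_funU => //; first by apply: measurableU => //; exact: measurableU.
split => //; apply/measurable_funU => //; first exact: measurableU.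
have cst0 (D : set R) : measurable D -> {in D, quantile mu =1 cst 0} ->
    measurable_fun D (quantile mu).
  move=> mD h; apply: (@eq_measurable_fun _ _ R R D (cst 0)) => [x /h -> //|].
  exact: measurable_cst.
split; [|apply/measurable_funU => //; split].
- apply: cst0 => // x; rewrite inE/= in_itv/= => x0.
  rewrite /quantile inf_out// => -[_ [m lbm]]; have := lbm (m - 1).
  rewrite lerBrDr gerDl ler10 => /(_ _)/notF; apply.
  by rewrite /= (@le_trans _ _ 0%E)// lee_fin.
- apply: cst0 => // x; rewrite inE/= in_itv/= andbT => x1.
  rewrite /quantile (_ : [set _ | _] = set0) ?inf0//.
  apply/seteqP; split => // t /= xt.
  have : (x%:E <= 1)%E by rewrite (le_trans xt)// probability_le1.
  by rewrite lee_fin leNgt x1.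
- by apply: measurable_fun_set1.
Qed.

Lemma probability_itvNyc_unique (R : realType) (m1 m2 : probability R R) :
  (forall t, m1 `]-oo, t]%classic = m2 `]-oo, t]%classic) ->
  forall B : set R, measurable B -> m1 B = m2 B.
Proof.
move=> m12 B mB.
pose G : set (set R) := [set `]-oo, t]%classic | t in setT].
apply: (@g_sigma_algebra_measure_unique _ R R G _ (fun n => `]-oo, n%:R]%classic)).
- by move=> _ [t _ <-].
- by move=> n; exists n%:R.
- apply/seteqP; split => // x _; exists (Num.truncn `|x|).+1 => //=.
  by rewrite in_itv/= (le_trans (ler_norm _))// ltW// truncnS_gt.
- move=> _ _ [a _ <-] [b _ <-]; exists (Num.min a b) => //.
  by apply/seteqP; split => x /=; rewrite !in_itv/= le_min; [move/andP|move=> ?; apply/andP].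
- by move=> _ [t _ <-]; exact: m12.
- by move=> k; rewrite (le_lt_trans (probability_le1 _ _))// ltry.
have mE : @measurable _ R = <<s @RGenInftyO.G R >>.
  exact: (@RGenInftyO.measurableE R).
move: mB; rewrite mE; apply: smallest_sub; first exact: smallest_sigma_algebra.
move=> _ [x ->].
rewrite [X in _ X](_ : _ = \bigcup_n `]-oo, x - n.+1%:R^-1]%classic); last first.
  apply/seteqP; split => [y /=|y [n _] /=]; rewrite !in_itv/=.
    move=> yx; have [|k] := @ltr_add_invr R 0 (x - y); first by rewrite subr_gt0.
    by rewrite add0r => kxy; exists k => //=; rewrite in_itv/= lerBrDl -lerBrDr ltW.
  by move=> /le_lt_trans; apply; rewrite ltrBlDr ltrDl invr_gt0.
apply: sigma_algebra_bigcup => n; apply: sub_sigma_algebra.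
by exists (x - n.+1%:R^-1).
Qed.

Lemma continuous_measurable_borel (R : realType) (T : ptopologicalType)
    (g : T -> R) : continuous g -> measurable_fun [set: borel T] g.
Proof.
move=> /continuousP cg; apply: (measurability (@RGenOpens.G R)).
  exact: RGenOpens.measurableE.
move=> _ [_ [a [b ->]] <-]; rewrite setTI; apply: sub_sigma_algebra.
by apply: cg; exact: interval_open.
Qed.

Lemma measurable_enorm (R : realType) n :
  measurable_fun [set: borel 'rV[R]_n] (@enorm R n).
Proof.
apply: (@measurableT_comp _ _ _ _ R R Num.sqrt _
  (fun v : borel 'rV[R]_n => \sum_(i < n) v ord0 i ^+ 2)).
  by apply: continuous_measurable_fun; exact: sqrt_continuous.
apply: measurable_sum => i; apply: measurable_funX.
by apply: continuous_measurable_borel; exact: coord_continuous.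
Qed.

Lemma uniform_prob01E (R : realType) (B : set R) : measurable B ->
  uniform_prob (@ltr01 R) B = lebesgue_measure (B `&` `]0, 1[%classic).
Proof.
move=> mB; rewrite /uniform_prob integral_uniform_pdf.
rewrite (eq_integral (cst 1%E)); last first.
  move=> x; rewrite inE => -[_ /=]; rewrite in_itv/= /uniform_pdf => ->.
  by rewrite subr0 invr1.
rewrite integral_cst/= ?mul1e; last exact: measurableI.
apply/eqP; rewrite eq_le; apply/andP; split; last first.
  apply: le_measure; rewrite ?inE; [exact: measurableI|exact: measurableI|].
  by apply: setIS; exact: subset_itv_oo_cc.
apply: (@le_trans _ _ (lebesgue_measure
    ((B `&` `]0, 1[%classic) `|` ([set 0] `|` [set 1])))).
  apply: le_measure; rewrite ?inE.
  - exact: measurableI.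
  - by apply: measurableU => //; [exact: measurableI|exact: measurableU].
  - move=> x [Bx]; rewrite /= !in_itv/= => /andP[x0 x1].
    have [->|xn0] := eqVneq x 0; first by right; left.
    have [->|xn1] := eqVneq x 1; first by right; right.
    by left; split => //; rewrite !lt_neqAle eq_sym xn0 x0 xn1.
apply: (le_trans (measureU2 _ _ _)) => //; [exact: measurableI|exact: measurableU|].
rewrite -[leRHS]adde0 leeD2l//.
apply: (le_trans (measureU2 _ _ _)) => //.
by rewrite /= !lebesgue_measure_set1 adde0.
Qed.

Lemma quantile_transform d (T : measurableType d) (R : realType)
    (P : probability T R) (U : {RV P >-> R}) (mu : probability R R) :
  uniform01 U ->
  forall B : set R, measurable B -> P ((quantile mu \o U) @^-1` B) = mu B.
Proof.
move=> hU.
have mq : measurable_fun [set: T] (quantile mu \o U).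
  exact: measurableT_comp (@measurable_quantile R mu) _.
pose X : {RV P >-> R} := mfun_Sub (mem_set mq).
apply: (@probability_itvNyc_unique R (distribution P X) mu) => t.
set F := mu `]-oo, t]%classic.
have Ffin : F \is a fin_num by rewrite fin_num_measure.
have F0 : 0 <= fine F by apply: fine_ge0; exact: measure_ge0.
have F1 : fine F <= 1 by rewrite -lee_fin fineK// probability_le1.
have mA : measurable (quantile mu @^-1` `]-oo, t]%classic).
  by rewrite -[X in measurable X]setTI; exact: measurable_quantile.
rewrite -[LHS]/(distribution P U (quantile mu @^-1` `]-oo, t]%classic)) hU//.
rewrite uniform_prob01E//.
rewrite (_ : _ `&` _ = `]0%R, fine F]%classic `&` `]0, 1[%classic); last first.
  apply/seteqP; split => a /=; rewrite !in_itv/= => -[h a01].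
    by move: h; rewrite quantile_le// -/F -(fineK Ffin) lee_fin => ->; case/andP: a01 => ->.
  by rewrite quantile_le// -/F -(fineK Ffin) lee_fin; case/andP: h => _ ->.
move: F1; rewrite le_eqVlt => /predU1P[F1|F1].
  rewrite F1 setIidr; last by move=> a /=; rewrite !in_itv/= => /andP[-> /ltW].
  by rewrite lebesgue_measure_itv/= lte_fin ltr01 oppr0 adde0 -(fineK Ffin) F1.
rewrite setIidl; last by move=> a /=; rewrite !in_itv/= => /andP[-> /le_lt_trans]; exact.
rewrite lebesgue_measure_itv/= lte_fin oppr0 adde0 fineK//.
by case: ltP => // F0'; rewrite -(fineK Ffin); congr EFin; apply/le_anti; rewrite F0.
Qed.

Lemma measurable_normr_powR (R : realType) (p : R) :
  measurable_fun [set: R] (fun t : R => (`|t| `^ p)%:E).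
Proof.
by apply/measurable_EFinP/(@measurableT_comp _ _ _ _ _ _ (@powR R ^~ p)).
Qed.

Lemma quantile_Lfun d (T : measurableType d) (R : realType)
    (P : probability T R) (U : {RV P >-> R}) (mu : probability R R) (p : R) :
  uniform01 U -> 1 <= p -> moment_set (fun t : R => `|t|) p mu ->
  quantile mu \o U \in Lfun P p%:E.
Proof.
move=> hU p1 mup.
have mq : measurable_fun [set: T] (quantile mu \o U).
  exact: measurableT_comp (@measurable_quantile R mu) _.
rewrite inE/=; apply/andP; split; rewrite inE//=.
pose X : {RV P >-> R} := mfun_Sub (mem_set mq).
rewrite /finite_norm unlock /Lnorm; apply: poweR_lty.
have := ge0_integral_distribution X (f := fun t : R => (`|t| `^ p)%:E).
move=> /(_ (measurable_normr_powR p)) <- => [|y]; last by rewrite lee_fin powR_ge0.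
by rewrite (eq_measure_integral mu)// => A mA _;
  exact: (quantile_transform mu hU mA).
Qed.

(* The library product measure lives on the product sigma-algebra; it is
   transported along the identity to the Borel sigma-algebra of R^n * R^s. *)
Definition dirac_prod (R : realType) n s (x : 'rV[R]_n)
    (nu : probability (borel 'rV[R]_s) R) :
    probability (borel ('rV[R]_n * 'rV[R]_s)%type) R :=
  distribution (dirac (x : borel 'rV[R]_n) \x nu)%E (@to_borel_prod R n s).

Lemma integral_dirac_prod (R : realType) n s (x : 'rV[R]_n)
    (nu : probability (borel 'rV[R]_s) R)
    (g : borel ('rV[R]_n * 'rV[R]_s)%type -> R) :
  measurable_fun setT g -> (forall z, 0 <= g z) ->
  (\int[dirac_prod x nu]_z (g z)%:E = \int[nu]_z (g (x, z))%:E)%E.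
Proof.
move=> mg g0; have mgE := (measurable_EFinP _ _).2 mg.
have mgE' : measurable_fun setT
    (fun z : borel 'rV[R]_n * borel 'rV[R]_s => (g z)%:E).
  exact: (measurableT_comp mgE (@measurable_to_borel_prod R n s)).
have gE0 (z : borel 'rV[R]_n * borel 'rV[R]_s) : (0 <= (g z)%:E)%E.
  by rewrite lee_fin.
rewrite ge0_integral_distribution//.
rewrite (fubini_tonelli1 (m1 := dirac (x : borel 'rV[R]_n)) (m2 := nu) _ mgE' gE0).
rewrite integral_dirac//=; first by rewrite diracT mul1e.
exact: measurable_fun_fubini_tonelli_F.
Qed.

Lemma image_moment (R : realType) n s
    (f : {mfun borel ('rV[R]_n * 'rV[R]_s)%type >-> R}) (gamma p : R) x
    (nu : probability (borel 'rV[R]_s) R) :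
  0 < gamma -> 1 <= p -> limited_by gamma f ->
  moment_set (T := borel 'rV[R]_s) (@enorm R s) (gamma * p) nu ->
  moment_set (fun t : R => `|t|) p (distribution (dirac_prod x nu) f).
Proof.
move=> g0 p1 [eta [_ eta0 feta]] hnu; rewrite /moment_set/=.
have p0 : 0 <= p by rewrite (le_trans ler01).
rewrite (ge0_integral_distribution _ (measurable_normr_powR p)); last first.
  by move=> y; rewrite lee_fin powR_ge0.
have mf : measurable_fun setT (fun z => `|f z| `^ p).
  apply: (@measurableT_comp _ _ _ _ _ _ (@powR R ^~ p)) => //.
  exact: measurableT_comp.
rewrite /comp (integral_dirac_prod x nu mf)//.
have bnd z : `|f (x, z)| `^ p <=
    (eta x * 2) `^ p * (enorm z `^ (gamma * p) + 1).
  have e0 : 0 <= enorm z `^ gamma by exact: powR_ge0.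
  apply: (@le_trans _ _ ((eta x * 2 * Num.max (enorm z `^ gamma) 1) `^ p)).
    apply: ge0_ler_powR => //; rewrite ?nnegrE//.
      by rewrite mulr_ge0// ?mulr_ge0// ?(ltW (eta0 x))// le_max e0.
    rewrite (le_trans (feta _ _))// -mulrA ler_pM2l// mulr_natl mulr2n.
    by rewrite lerD// le_max lexx ?orbT.
  have e20 : 0 <= eta x * 2 by rewrite mulr_ge0// ltW.
  rewrite powRM ?le_max ?e0// ler_wpM2l ?powR_ge0//.
  have [_|_] := leP (enorm z `^ gamma) 1.
    by rewrite powR1 lerDr powR_ge0.
  by rewrite powRrM lerDl.
have me : measurable_fun [set: borel 'rV[R]_s]
    (fun z => enorm z `^ (gamma * p)).
  apply: (@measurableT_comp _ _ _ _ _ _ (@powR R ^~ _)) => //.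
  exact: measurable_enorm.
have meE : measurable_fun [set: borel 'rV[R]_s]
    (fun z => (enorm z `^ (gamma * p))%:E) by exact/measurable_EFinP.
have me1 : measurable_fun [set: borel 'rV[R]_s]
    (fun z => (enorm z `^ (gamma * p))%:E + 1)%E by exact: emeasurable_funD.
have mfx : measurable_fun [set: borel 'rV[R]_s]
    (fun z : borel 'rV[R]_s => (`|f (x, z)| `^ p)%:E).
  apply/measurable_EFinP.
  have mpair : measurable_fun setT
      (fun z : borel 'rV[R]_s => to_borel_prod ((x : borel 'rV[R]_n), z)).
    apply: measurableT_comp; first exact: measurable_to_borel_prod.
    exact: pair1_measurable.
  exact: (measurableT_comp mf mpair).
apply: (@le_lt_trans _ _ (\int[nu]_z
    (((eta x * 2) `^ p)%:E * ((enorm z `^ (gamma * p))%:E + 1)))%E).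
  apply: ge0_le_integral => //.
  - by apply: emeasurable_funM.
  - by move=> z _; rewrite -EFinD -EFinM lee_fin.
rewrite ge0_integralZl//; last 2 first.
- by move=> z _; rewrite adde_ge0// lee_fin powR_ge0.
- by rewrite lee_fin powR_ge0.
rewrite ge0_integralD//; last by move=> z _; rewrite lee_fin powR_ge0.
rewrite integral_cst//= probability_setT mul1e.
by rewrite lte_mul_pinfty// ?lee_fin ?powR_ge0// lte_add_pinfty ?ltry.
Qed.

Section weak_convergence.
Context (R : realType) (T : ptopologicalType).

Record bounded_continuous := BoundedContinuous {
  bc_fun :> T -> R ;
  bc_continuous : continuous bc_fun ;
  bc_bounded : bounded_fun bc_fun }.

Definition bc_integral (mu : probability (borel T) R) :
    {ptws bounded_continuous -> R} :=
  fun g => \int[mu]_z g z.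

(* Topology of weak convergence: the coarsest topology for which all the maps
   [mu |-> \int[mu]_z g z] with [g] bounded and continuous are continuous. *)
Definition weak_probability := initial_topology bc_integral.

HB.instance Definition _ := Topological.on weak_probability.

Definition locally_uniformly_integrating (N : T -> R) (q : R)
    (M : set weak_probability) : Prop :=
  forall (eps : R) (nu : weak_probability), 0 < eps -> M nu ->
  exists L : set weak_probability, [/\ open L, L nu &
    (lim (ereal_sup [set \int[mu : probability (borel T) R]_z
                           (N z `^ q * \1_(`]a, +oo[) (N z `^ q))%:E
                    | mu in L `&` M] @[a --> +oo%R]) <= eps%:E)%E].

End weak_convergence.

Section risk.
Context d (T : measurableType d) (R : realType) (P : probability T R).
Context (p : R) (hp : (1 <= p%:E)%E).

(* Elements of L^p are given by representatives; a functional that is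
   monotone for the almost sure order is well defined on classes, see
   [ae_nondecreasing_congr]. *)
Implicit Types (rho : LfunType P hp -> R) (Y Z : LfunType P hp).

Definition convex_risk rho : Prop :=
  forall Y Z (t : R), 0 <= t <= 1 ->
    rho (t *: Y + (1 - t) *: Z) <= t * rho Y + (1 - t) * rho Z.

Definition ae_nondecreasing rho : Prop :=
  forall Y Z, {ae P, forall w, Y w <= Z w} -> rho Y <= rho Z.

Lemma ae_nondecreasing_congr rho Y Z : ae_nondecreasing rho ->
  {ae P, forall w, Y w = Z w} -> rho Y = rho Z.
Proof.
move=> hrho YZ; apply/le_anti/andP; split; apply: hrho;
  by apply: filterS YZ => w ->.
Qed.

Definition law_invariant rho : Prop :=
  forall Y Z,
    (forall B : set R, measurable B ->
       distribution P Y B = distribution P Z B) ->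
    rho Y = rho Z.

(* The default value [0] is never used for [mu] with a finite [p]-th absolute
   moment, by [quantile_Lfun]; [image_moment] gives this moment condition for
   the image measures in [image_risk]. *)
Definition risk_functional rho (U : {RV P >-> R}) (mu : probability R R) : R :=
  rho (insubd (0 : LfunType P hp) (quantile mu \o U)).

Definition image_risk rho (U : {RV P >-> R}) n s
    (f : {mfun borel ('rV[R]_n * 'rV[R]_s)%type >-> R})
    (y : 'rV[R]_n * weak_probability R 'rV[R]_s) : R :=
  risk_functional rho U (distribution (dirac_prod y.1 y.2) f).

End risk.

(* Main.v *)
(* Finiteness, convexity and monotonicity already make rho continuous in L^p:
   if \sum_k (k+1)^p E|Y_k - X|^p < oo, then some W in L^p dominates every
   (k+1)|Y_k - X|, so Y_k <= (1 - t) X + t (X + W) with t = 1/(k+1), hence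
   rho(Y_k) - rho(X) <= t (rho(X + W) - rho(X)); applying this to the reflection
   2X - Y_k gives the lower bound. It remains to see that the quantile
   transforms of the image laws converge in L^p. They converge almost surely,
   except at the countably many values of the limit distribution function at
   rational points, because the image laws converge weakly; and they are
   uniformly p-integrable by the growth of f and the local uniform
   integrability of M. Weak convergence of the image laws is obtained without
   the portmanteau theorem: h = phi o f lies below its k-Lipschitz envelope,
   which varies little in x, is a test function in z, and tends to h as k
   grows wherever h is continuous. Only countably many of these conditions are
   needed, so that sequences suffice although the weak topology is given
   without a countable basis. *)
Require Import Defs.
From HB Require Import structures.
From mathcomp Require Import all_boot all_order all_algebra.
From mathcomp Require Import all_classical all_reals all_analysis.
From mathcomp Require Import measurable_realfun.
From mathcomp Require Import lra ring.

Set Implicit Arguments.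
Unset Strict Implicit.
Unset Printing Implicit Defensive.

Import Order.TTheory GRing.Theory Num.Theory.
Import numFieldNormedType.Exports.

Local Open Scope classical_set_scope.
Local Open Scope ring_scope.

(** * Domination in [L^p] and continuity of [rho] along fast sequences *)

Lemma measurable_normr_powR_comp d (T : measurableType d) (R : realType)
    (p : R) (g : T -> R) :
  measurable_fun setT g -> measurable_fun setT (fun w => `|g w| `^ p).
Proof.
move=> mg; apply: (@measurableT_comp _ _ _ _ _ _ (@powR R ^~ p)) => //.
exact: measurableT_comp.
Qed.

Lemma Lfun_powR_integral d (T : measurableType d) (R : realType)
    (P : probability T R) (p : R) (g : T -> R) :
  measurable_fun setT g -> (\int[P]_w (`|g w| `^ p)%:E < +oo)%E ->
  g \in Lfun P p%:E.
Proof.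
move=> mg gp; rewrite inE/=; apply/andP; split; rewrite inE//=.
by rewrite /finite_norm unlock /Lnorm; exact: poweR_lty.
Qed.

(* [W] is the [p]-th root of [\sum_k V k ^ p]. *)
Lemma Lfun_dominating d (T : measurableType d) (R : realType)
    (P : probability T R) (p : R) (hp : (1 <= p%:E)%E) (V : nat -> T -> R) :
  (forall k, measurable_fun setT (V k)) -> (forall k w, 0 <= V k w) ->
  (\sum_(k <oo) \int[P]_w (V k w `^ p)%:E < +oo)%E ->
  exists W : LfunType P hp, forall k, {ae P, forall w, V k w <= W w}.
Proof.
move=> mV V0 sV.
have p1 : 1 <= p by rewrite -lee_fin.
have p0 : 0 < p by rewrite (lt_le_trans ltr01).
pose S w := (\sum_(k <oo) (V k w `^ p)%:E)%E.
have mVp k : measurable_fun setT (fun w => (V k w `^ p)%:E).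
  by apply/measurable_EFinP; apply: (@measurableT_comp _ _ _ _ _ _ (@powR R ^~ p)).
have S0 w : (0 <= S w)%E by apply: nneseries_ge0 => n _ _; rewrite lee_fin powR_ge0.
have mS : measurable_fun setT S.
  by apply: ge0_emeasurable_sum => // k w _ _; rewrite lee_fin powR_ge0.
have iS : (\int[P]_w S w < +oo)%E.
  by rewrite integral_nneseries// => k w _; rewrite lee_fin powR_ge0.
pose W w := fine (S w) `^ p^-1.
have mW : measurable_fun setT W.
  apply: (@measurableT_comp _ _ _ _ _ _ (@powR R ^~ p^-1)) => //.
  exact: measurableT_comp.
have WL : W \in Lfun P p%:E.
  apply: Lfun_powR_integral => //; apply: le_lt_trans iS.
  apply: ge0_le_integral => //.
    by apply/measurable_EFinP; exact: measurable_normr_powR_comp.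
  move=> w _; rewrite /W ger0_norm ?powR_ge0// -powRrM mulVf ?gt_eqF//.
  rewrite powRr1 ?fine_ge0//.
  by case: (S w) (S0 w) => //=.
exists (Sub W WL) => k.
(* [fine] sends [+oo] to [0], so domination is obtained only where [S] is finite, which
   integrability of [S] makes almost everywhere. *)
have /integrable_ae-/(_ measurableT) : P.-integrable setT S.
  apply/integrableP; split => //.
  by under eq_integral do rewrite gee0_abs//.
apply: filterS => w /(_ I) Sfin; rewrite SubK /W.
rewrite -[leLHS](@powRr1 _ (V k w)) ?V0// -(@mulfV _ p) ?gt_eqF//.
rewrite powRrM; apply: ge0_ler_powR.
- by rewrite invr_ge0 ltW.
- by rewrite nnegrE powR_ge0.
- by rewrite nnegrE fine_ge0.
rewrite -lee_fin fineK//.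
(* The partial sum up to [k.+1] excluded is the first to contain the term of index [k]. *)
have := @nneseries_lim_ge R (fun k => (V k w `^ p)%:E) xpredT 0 k.+1.
move=> /(_ (fun k _ _ => powR_ge0 _ _)); apply: le_trans.
by rewrite big_nat_recr//= leeDr// sume_ge0// => i _; rewrite lee_fin powR_ge0.
Qed.

Lemma convex_monotone_cvg d (T : measurableType d) (R : realType)
    (P : probability T R) (p : R) (hp : (1 <= p%:E)%E)
    (rho : LfunType P hp -> R) (X : LfunType P hp) (Y : nat -> LfunType P hp) :
  convex_risk rho -> ae_nondecreasing rho ->
  (\sum_(k <oo) \int[P]_w ((k.+1%:R * `|Y k w - X w|) `^ p)%:E < +oo)%E ->
  exists C, forall k, `|rho (Y k) - rho X| <= C / k.+1%:R.
Proof.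
move=> cvx mono sV.
have [||W hW] := @Lfun_dominating d T R P p hp
    (fun k w => k.+1%:R * `|Y k w - X w|) _ _ sV.
- move=> k; apply: measurable_funM => //.
  by apply: measurableT_comp => //; exact: measurable_funB.
- by move=> k w; rewrite mulr_ge0.
have bnd (V : LfunType P hp) k :
    {ae P, forall w, k.+1%:R * (V w - X w) <= W w} ->
    rho V - rho X <= (rho (X + W) - rho X) / k.+1%:R.
  move=> hV; pose t : R := k.+1%:R^-1.
  have k0 : 0 < k.+1%:R :> R by [].
  have t0 : 0 < t by rewrite invr_gt0.
  have t1 : t <= 1 by rewrite invf_le1// ler1n.
  have := cvx (X + W) X t; rewrite (ltW t0) t1 => /(_ isT).
  have : rho V <= rho (t *: (X + W) + (1 - t) *: X).
    apply: mono; apply: filterS hV => w hw.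
    have -> : (t *: (X + W) + (1 - t) *: X : LfunType P hp) w =
      t * (X w + W w) + (1 - t) * X w by [].
    have : V w - X w <= t * W w by rewrite mulrC ler_pdivlMr// mulrC.
    by move: (V w) (X w) (W w) => a b c; nra.
  by rewrite -/t; move: (rho _) (rho _) (rho _) (rho _) => a b c e; nra.
exists (rho (X + W) - rho X) => k; rewrite ler_norml; apply/andP; split.
(* [X] is the midpoint of [Y k] and its reflection [V], so convexity gives
   [rho X - rho (Y k) <= rho V - rho X]. *)
- pose V : LfunType P hp := X + (X - Y k).
  have : rho V - rho X <= (rho (X + W) - rho X) / k.+1%:R.
    apply: bnd; have := hW k; apply: filterS => w; apply: le_trans.
    have -> : V w = X w + (X w - Y k w) by [].
    by rewrite ler_wpM2l// addrAC subrr add0r distrC ler_norm.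
  have := cvx V (Y k) 2^-1; rewrite invr_ge0 ler0n invf_le1// ler1n => /(_ isT).
  have -> : 2^-1 *: V + (1 - 2^-1) *: Y k = X.
    apply/LfuneqP => w.
    have -> : (2^-1 *: V + (1 - 2^-1) *: Y k) w =
      2^-1 * (X w + (X w - Y k w)) + (1 - 2^-1) * Y k w by [].
    by field.
  set c := (_ / _) in |- *; move: (rho V) (rho X) (rho (Y k)) c => a b e c; lra.
- apply: bnd; have := hW k; apply: filterS => w; apply: le_trans.
  by rewrite ler_wpM2l// ler_norm.
Qed.

(** * Convergence of quantile functions, almost surely and in [L^p] *)

Lemma ltr_exists_inv (R : realType) (e : R) : 0 < e ->
  exists j : nat, j.+1%:R^-1 < e.
Proof.
by move=> e0; have [j] := @ltr_add_invr R 0 e e0; rewrite add0r; exists j.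
Qed.

Lemma rat_in_itvoo2 (R : realType) (x y : R) : x < y ->
  exists a b : rat, [/\ x < ratr a, a < b & ratr b < y].
Proof.
move=> /rat_in_itvoo[a]; rewrite in_itv/= => /andP[xa /rat_in_itvoo[b]].
by rewrite in_itv/= ltr_rat => /andP[ab bY]; exists a, b.
Qed.

(** Closeness in the manner of the Lévy metric: the shift from [a] to [b] absorbs atoms of the
    limit, at which distribution functions need not converge. *)
Definition cdf_close (R : realType) (m m' : probability R R) (a b e : R) :=
  (m' `]-oo, a]%classic <= m `]-oo, b]%classic + e%:E)%E /\
  (m `]-oo, a]%classic <= m' `]-oo, b]%classic + e%:E)%E.

Definition tail_moment (R : realType) (p b : R) (m : probability R R) : \bar R :=
  (\int[m]_t (`|t| `^ p * \1_(`]b, +oo[%classic) (`|t| `^ p))%:E)%E.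

(* The excluded levels [alpha] include those of the jumps of [quantile m]: there
   the distribution function of [m] equals [alpha] on an interval. *)
Lemma quantile_cvg (R : realType) (m_ : nat -> probability R R)
    (m : probability R R) (alpha : R) :
  0 < alpha < 1 ->
  (forall (a b : rat) (j : nat), a < b -> \forall k \near \oo,
    cdf_close m (m_ k) (ratr a) (ratr b) j.+1%:R^-1) ->
  (forall a : rat, m `]-oo, ratr a]%classic <> alpha%:E) ->
  quantile (m_ k) alpha @[k --> \oo] --> quantile m alpha.
Proof.
move=> a01 close neq; apply/cvgrPdist_lt => e e0.
set q := quantile m alpha.
have mfin (m' : probability R R) (t : R) : m' `]-oo, t]%classic \is a fin_num.
  exact: fin_num_measure.
have up : \forall k \near \oo, quantile (m_ k) alpha < q + e.
  have [|a [b [qa ab be]]] := @rat_in_itvoo2 R q (q + e); first by rewrite ltrDl.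
  (* Strict because [alpha] is not an excluded level; the resulting gap leaves room for the error
     [j.+1%:R^-1] of [cdf_close]. *)
  have : (alpha%:E < m `]-oo, ratr a]%classic)%E.
    rewrite lt_neqAle -quantile_le// (ltW qa) andbT eq_sym; exact/eqP/neq.
  rewrite -(fineK (mfin _ _)) lte_fin -subr_gt0 => /ltr_exists_inv[j ja].
  have := close a b j ab; apply: filterS => k -[_].
  rewrite -(fineK (mfin m _)) -(fineK (mfin (m_ k) _)) -EFinD lee_fin => h.
  apply: le_lt_trans be; rewrite quantile_le// -(fineK (mfin (m_ k) _)) lee_fin.
  move: ja h; move: (fine _) (fine _) (_^-1) => u v r; lra.
have lo : \forall k \near \oo, q - e < quantile (m_ k) alpha.
  have [|a [b [qa ab be]]] := @rat_in_itvoo2 R (q - e) q.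
    by rewrite ltrBlDr ltrDl.
  (* Here strictness is automatic: left of [q] the distribution function stays below [alpha]. *)
  have : (m `]-oo, ratr b]%classic < alpha%:E)%E.
    by rewrite ltNge -quantile_le// -ltNge.
  rewrite -(fineK (mfin _ _)) lte_fin -subr_gt0 => /ltr_exists_inv[j ja].
  have := close a b j ab; apply: filterS => k -[].
  rewrite -(fineK (mfin m _)) -(fineK (mfin (m_ k) _)) -EFinD lee_fin => h _.
  apply: lt_trans qa _; rewrite ltNge quantile_le// -ltNge.
  rewrite -(fineK (mfin (m_ k) _)) lte_fin.
  move: ja h; move: (fine _) (fine _) (_^-1) => u v r; lra.
near=> k; rewrite ltr_distlC; apply/andP; split.
- by near: k.
- by near: k.
Unshelve. all: end_near. Qed.

Lemma uniform01_ae d (T : measurableType d) (R : realType)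
    (P : probability T R) (U : {RV P >-> R}) (C : set R) :
  uniform01 U -> countable C ->
  {ae P, forall w, 0 < U w < 1 /\ ~ C (U w)}.
Proof.
move=> hU cC; have mC : measurable C by exact: countable_measurable.
have mB : measurable (~` `]0%R, 1%R[%classic `|` C).
  by apply: measurableU => //; exact: measurableC.
exists (U @^-1` (~` `]0%R, 1%R[%classic `|` C)); split.
- by rewrite -[X in measurable X]setTI; exact: measurable_funP.
- rewrite -[LHS]/(distribution P U _) hU// uniform_prob01E//.
  apply/eqP; rewrite eq_le measure_ge0 andbT.
  apply: (@le_trans _ _ (lebesgue_measure C)).
    apply: le_measure; rewrite ?inE//; first exact: measurableI.
    by move=> t [[|//] /=].
  by rewrite countable_lebesgue_measure0.
- move=> w /= h; apply: contrapT => /not_orP[h1 h2]; apply: h; split=> //.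
  by move/contrapT : h1; rewrite in_itv.
Qed.

(** As [|x - y|] is at most twice the larger of [|x|] and [|y|], a value of [|x - y| ^ p] above
    [2 ^ p * |b|] puts the larger one into its tail. The minimum is the bounded part, to which
    dominated convergence will apply. *)
Lemma powR_dist_le_tail (R : realType) (p b x y : R) : 0 <= p ->
  `|x - y| `^ p <= Num.min (`|x - y| `^ p) (2 `^ p * `|b|) +
    2 `^ p * (`|x| `^ p * \1_(`]b, +oo[%classic) (`|x| `^ p) +
              `|y| `^ p * \1_(`]b, +oo[%classic) (`|y| `^ p)).
Proof.
move=> p0; have D0 : 0 < 2 `^ p :> R by rewrite powR_gt0.
have tail0 (t : R) : 0 <= `|t| `^ p * \1_(`]b, +oo[%classic) (`|t| `^ p).
  by rewrite mulr_ge0// ?powR_ge0// indicE.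
have [h|h] := leP (`|x - y| `^ p) (2 `^ p * `|b|).
  by rewrite lerDl mulr_ge0 ?addr_ge0// ltW.
have key (u v : R) : `|v| <= `|u| -> 2 `^ p * `|b| < `|u - v| `^ p ->
    `|u - v| `^ p <= 2 `^ p * (`|u| `^ p * \1_(`]b, +oo[%classic) (`|u| `^ p)).
  move=> vu buv.
  have uv : `|u - v| `^ p <= 2 `^ p * `|u| `^ p.
    rewrite -powRM//; apply: ge0_ler_powR => //; rewrite ?nnegrE ?mulr_ge0//.
    by rewrite (le_trans (ler_normB _ _))// mulr_natl mulr2n lerD.
  have bu : b < `|u| `^ p.
    rewrite (le_lt_trans (ler_norm b))//.
    by rewrite -(ltr_pM2l D0) (lt_le_trans buv).
  by rewrite indicE mem_set ?mulr1//= in_itv/= bu.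
have Db : 0 <= 2 `^ p * `|b| by rewrite mulr_ge0// ltW.
apply: (@le_trans _ _ (2 `^ p * (`|x| `^ p * \1_(`]b, +oo[%classic) (`|x| `^ p) +
              `|y| `^ p * \1_(`]b, +oo[%classic) (`|y| `^ p)))); last by rewrite lerDr.
have [yx|/ltW xy] := leP `|y| `|x|.
  apply: (le_trans (key _ _ yx h)).
  by rewrite ler_wpM2l ?(ltW D0)// lerDl.
rewrite distrC in h *; apply: (le_trans (key _ _ xy h)).
by rewrite ler_wpM2l ?(ltW D0)// lerDr.
Qed.

Lemma measurable_tail (R : realType) (p b : R) :
  measurable_fun [set: R] (fun t : R => `|t| `^ p * \1_(`]b, +oo[%classic) (`|t| `^ p)).
Proof.
have mp : measurable_fun [set: R] (fun t : R => `|t| `^ p).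
  exact: measurable_normr_powR_comp.
apply: measurable_funM => //.
apply: (@measurableT_comp _ _ _ _ _ _ (\1_(`]b, +oo[%classic) : R -> R)) => //.
Qed.

Lemma tail_moment_quantile d (T : measurableType d) (R : realType)
    (P : probability T R) (U : {RV P >-> R}) (p b : R) (m : probability R R) :
  uniform01 U ->
  (\int[P]_w (`|quantile m (U w)| `^ p *
     \1_(`]b, +oo[%classic) (`|quantile m (U w)| `^ p))%:E = tail_moment p b m)%E.
Proof.
move=> hU.
have mq : measurable_fun [set: T] (quantile m \o U).
  exact: measurableT_comp (@measurable_quantile R m) _.
pose X : {RV P >-> R} := mfun_Sub (mem_set mq).
have := ge0_integral_distribution X
  (f := fun t : R => (`|t| `^ p * \1_(`]b, +oo[%classic) (`|t| `^ p))%:E).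
move=> <-.
- apply: eq_measure_integral => A mA _; exact: (quantile_transform m hU mA).
- by apply/measurable_EFinP; exact: measurable_tail.
- by move=> y; rewrite lee_fin mulr_ge0// ?powR_ge0// indicE.
Qed.

(** Vitali's argument: the truncated distance tends to zero almost surely and hence in mean, while
    the excess is controlled by the tails of the two laws. *)
Lemma quantile_Lp_cvg d (T : measurableType d) (R : realType)
    (P : probability T R) (U : {RV P >-> R}) (p : R)
    (m_ : nat -> probability R R) (m : probability R R) :
  uniform01 U -> 1 <= p ->
  (forall (a b : rat) (j : nat), a < b -> \forall k \near \oo,
    cdf_close m (m_ k) (ratr a) (ratr b) j.+1%:R^-1) ->
  (forall j : nat, exists b, (tail_moment p b m <= j.+1%:R^-1%:E)%E /\
    \forall k \near \oo, (tail_moment p b (m_ k) <= j.+1%:R^-1%:E)%E) ->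
  forall e : R, 0 < e -> \forall k \near \oo,
    (\int[P]_w (`|quantile (m_ k) (U w) - quantile m (U w)| `^ p)%:E <= e%:E)%E.
Proof.
move=> hU p1 close tail e e0.
have p0 : 0 < p by rewrite (lt_le_trans ltr01).
pose D : R := 2 `^ p.
have D0 : 0 < D by rewrite powR_gt0.
(* The two tails together cost [D * 2 / (j + 1) < e / 2]; the other half of [e] goes to the
   truncated part. *)
have [j je] : exists j : nat, j.+1%:R^-1 < e / (4 * D).
  by apply: ltr_exists_inv; rewrite divr_gt0// mulr_gt0.
have [b [tb tbk]] := tail j.
have mqU (m' : probability R R) : measurable_fun setT (fun w => quantile m' (U w)).
  exact: measurableT_comp (@measurable_quantile R m') _.
pose V k w := `|quantile (m_ k) (U w) - quantile m (U w)| `^ p.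
have mV k : measurable_fun setT (V k).
  by apply: measurable_normr_powR_comp; exact: measurable_funB.
pose G k w := Num.min (V k w) (D * `|b|).
have mG k : measurable_fun setT (G k) by exact: measurable_minr.
have Db0 : 0 <= D * `|b| by rewrite mulr_ge0// ltW.
have G0 k w : 0 <= G k w by rewrite le_min powR_ge0.
(* The levels excluded in [quantile_cvg]; being countably many, they are missed by [U] almost
   surely. *)
have hC : countable (range (fun a : rat => fine (m `]-oo, (ratr a : R)]%classic))).
  by apply: sub_countable (card_image_le _ _) _; exact: countableP.
have Gcvg : {ae P, forall w, [set: T] w ->
    (G k w)%:E @[k --> \oo] --> (cst 0%E : T -> \bar R) w}.
  have := uniform01_ae hU hC; apply: filterS => w [u01 uC] _.
  apply: cvg_EFin; first by apply: nearW.
  apply/cvgrPdist_lt => r r0.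
  have r'0 : 0 < r `^ p^-1 by rewrite powR_gt0.
  have : quantile (m_ k) (U w) @[k --> \oo] --> quantile m (U w).
    apply: quantile_cvg => // a aU; apply: uC; exists a => //=.
    by rewrite aU.
  move=> /cvgrPdist_lt/(_ _ r'0); apply: filterS => k hk.
  rewrite sub0r normrN ger0_norm//= gt_min; apply/orP; left.
  rewrite /V distrC -[ltRHS](@powRr1 _ r) ?(ltW r0)// -(@mulVf _ p) ?gt_eqF// powRrM.
  by apply: gt0_ltr_powR => //; rewrite nnegrE// ltW.
have ig : P.-integrable setT (cst (D * `|b|)%:E : T -> \bar R).
  exact: finite_measure_integrable_cst.
have dom : {ae P, forall w n, [set: T] w -> (`|(G n w)%:E| <= (D * `|b|)%:E)%E}.
  by apply: aeW => w k _; rewrite lee_fin ger0_norm// ge_min lexx orbT.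
have [_ _] := dominated_convergence measurableT
  (fun k => (measurable_EFinP _ _).2 (mG k)) (measurable_cst _) Gcvg ig dom.
rewrite integral0 => Gcvg0.
have e20 : 0 < e / 2 by rewrite divr_gt0.
have Gsmall : \forall k \near \oo, (\int[P]_w (G k w)%:E < (e / 2)%:E)%E.
  apply: (Gcvg0 [set y | (y < (e / 2)%:E)%E]).
  by apply: open_nbhs_nbhs; split; [exact: open_ereal_lt_ereal|rewrite /= lte_fin].
near=> k.
pose tl (m' : probability R R) w := `|quantile m' (U w)| `^ p *
     \1_(`]b, +oo[%classic) (`|quantile m' (U w)| `^ p).
have mtl m' : measurable_fun setT (tl m').
  exact: (measurableT_comp (measurable_tail p b) (mqU m')).
have tl0 m' w : 0 <= tl m' w by rewrite mulr_ge0// ?powR_ge0// indicE.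
apply: (@le_trans _ _ (\int[P]_w
    ((G k w)%:E + D%:E * ((tl (m_ k) w)%:E + (tl m w)%:E)))%E).
  apply: ge0_le_integral => //.
  - exact/measurable_EFinP/mV.
  - apply: emeasurable_funD; first exact/measurable_EFinP.
    apply: emeasurable_funM => //; apply: emeasurable_funD; exact/measurable_EFinP.
  - move=> w _; exact: (powR_dist_le_tail b _ _ (ltW p0)).
rewrite ge0_integralD//; last 4 first.
- by move=> w _; rewrite lee_fin.
- exact/measurable_EFinP.
- by move=> w _; rewrite lee_fin mulr_ge0// ?addr_ge0// ltW.
- by apply: emeasurable_funM => //; apply: emeasurable_funD; exact/measurable_EFinP.
rewrite ge0_integralZl//; last 3 first.
- by apply: emeasurable_funD; exact/measurable_EFinP.
- by move=> w _; rewrite -EFinD lee_fin addr_ge0.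
- by rewrite lee_fin ltW.
rewrite ge0_integralD//; last 4 first.
- by move=> w _; rewrite lee_fin.
- exact/measurable_EFinP.
- by move=> w _; rewrite lee_fin.
- exact/measurable_EFinP.
rewrite !tail_moment_quantile//.
apply: (@le_trans _ _ ((e / 2)%:E + D%:E * (j.+1%:R^-1%:E + j.+1%:R^-1%:E))%E).
  rewrite leeD//; first by apply: ltW; near: k.
  rewrite lee_wpmul2l ?lee_fin ?(ltW D0)// leeD//; near: k; exact: tbk.
rewrite lee_fin.
move: je; rewrite ltr_pdivlMr ?mulr_gt0//; move: (j.+1%:R^-1) => c.
lra.
Unshelve. all: end_near. Qed.

(** * Lipschitz envelopes *)

Section lipschitz_envelope.
Context (R : realType) (V : normedModType R).

(* The least [k]-Lipschitz function above [h]. *)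
Definition lip_envelope (h : V -> R) (k : R) (u : V) : R :=
  sup (range (fun v => h v - k * `|u - v|)).

Variables (h : V -> R) (k : R).
Hypotheses (h01 : forall u, 0 <= h u <= 1) (k0 : 0 <= k).

Let bnd (u v : V) : h v - k * `|u - v| <= 1.
Proof. by rewrite lerBlDr ler_wpDr ?mulr_ge0//; case/andP: (h01 v). Qed.

(** Ensures that [sup] is a genuine supremum and not its default value. *)
Let has_sup_env (u : V) : has_sup (range (fun v => h v - k * `|u - v|)).
Proof. by split; [exists (h 0 - k * `|u - 0|), 0|exists 1 => _ [v _ <-]]. Qed.

Lemma lip_envelope_ub (u v : V) : h v - k * `|u - v| <= lip_envelope h k u.
Proof. by apply: ub_le_sup; [case: (has_sup_env u)|exists v]. Qed.

Lemma lip_envelope_le (u : V) (c : R) :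
  (forall v, h v - k * `|u - v| <= c) -> lip_envelope h k u <= c.
Proof. by move=> hc; apply: ge_sup => [|_ [v _ <-]//]; case: (has_sup_env u). Qed.

Lemma lip_envelope_ge (u : V) : h u <= lip_envelope h k u.
Proof.
by apply: le_trans (lip_envelope_ub u u); rewrite subrr normr0 mulr0 subr0.
Qed.

Lemma lip_envelope01 (u : V) : 0 <= lip_envelope h k u <= 1.
Proof.
rewrite (le_trans _ (lip_envelope_ge u)); last by case/andP: (h01 u).
exact: lip_envelope_le.
Qed.

Lemma lip_envelopeD (u v : V) :
  lip_envelope h k u <= lip_envelope h k v + k * `|u - v|.
Proof.
apply: lip_envelope_le => w; rewrite -lerBlDr -addrA -opprD -mulrDr.
apply: le_trans (lip_envelope_ub v w).
by rewrite lerD2l lerN2 ler_wpM2l// [leRHS]addrC (distrC u v) ler_distD.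
Qed.

Lemma lip_envelope_continuous : continuous (lip_envelope h k).
Proof.
move=> u; apply/cvgrPdist_lt => e e0.
(* [k + 1] in place of [k], which may be zero. *)
have ek : 0 < e / (k + 1) by rewrite divr_gt0// ltr_wpDl.
near=> v.
have uv : k * `|u - v| < e.
  apply: (@le_lt_trans _ _ ((k + 1) * `|u - v|)).
    by rewrite ler_wpM2r// lerDl.
  rewrite mulrC -ltr_pdivlMr ?ltr_wpDl//; near: v.
apply: le_lt_trans uv; rewrite ler_norml; apply/andP; split.
  by rewrite lerNl opprB lerBlDl distrC lip_envelopeD.
by rewrite lerBlDl lip_envelopeD.
Unshelve. all: end_near. Qed.

End lipschitz_envelope.

(** Within distance [r] of [u], continuity keeps [h v] below [h u + e]; farther away, the penalty
    [k * |u - v|] is at least [1] once [k * r >= 1] and cancels [h v <= 1]. *)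
Lemma lip_envelope_cvg (R : realType) (V : normedModType R) (h : V -> R) (u : V) :
  (forall v, 0 <= h v <= 1) -> {for u, continuous h} ->
  lip_envelope h k%:R u @[k --> \oo] --> h u.
Proof.
move=> h01 hu; apply/cvgrPdist_le => e e0.
have /cvgrPdist_le/(_ _ e0) := hu.
move=> /nbhs_ballP[r /= r0 hr].
exists (Num.truncn r^-1).+1 => // k /= kr.
have kr1 : 1 <= k%:R * r.
  rewrite -ler_pdivrMr// mul1r (le_trans (ltW (truncnS_gt _)))//.
  by rewrite ler_nat.
rewrite distrC ger0_norm ?subr_ge0 ?lip_envelope_ge// lerBlDr.
apply: lip_envelope_le => // v.
have [uv|uv] := ltP `|u - v| r.
  have := hr v; rewrite -ball_normE /= => /(_ uv).
  rewrite ler_norml => /andP[+ _]; rewrite lerNl opprB => hv.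
  rewrite lerBlDr ler_wpDr ?mulr_ge0//; move: hv; lra.
have : 1 <= k%:R * `|u - v| by rewrite (le_trans kr1)// ler_wpM2l.
have /andP[_] := h01 v; have /andP[] := h01 u; lra.
Qed.

(** * Integrals under joint perturbation of the point and of the measure *)

Lemma measurable_section (R : realType) n s
    (h : borel ('rV[R]_n * 'rV[R]_s)%type -> R) (x : 'rV[R]_n) :
  measurable_fun setT h ->
  measurable_fun setT (fun z : borel 'rV[R]_s => h (x, z)).
Proof.
move=> mh; have mpair : measurable_fun setT
    (fun z : borel 'rV[R]_s => to_borel_prod ((x : borel 'rV[R]_n), z)).
  apply: measurableT_comp; first exact: measurable_to_borel_prod.
  exact: pair1_measurable.
exact: (measurableT_comp mh mpair).
Qed.

Lemma bc_integral_continuous (R : realType) (T : ptopologicalType)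
    (g : bounded_continuous R T) :
  continuous (fun mu : weak_probability R T => bc_integral mu g).
Proof.
move=> mu; apply: (@continuous_comp _ _ _ (@bc_integral R T : weak_probability R T -> _)
   (fun F : {ptws bounded_continuous R T -> R} => F g)).
  exact: initial_continuous.
exact: (@proj_continuous {classic bounded_continuous R T} (fun=> R) g).
Qed.

(** Through the envelope, [h (y.1, z) <= G k (y.1, z) <= G k (x, z) + k * |y.1 - x|], so the
    perturbed measure only integrates the fixed test function [G k (x, _)]. Continuity of [h] serves
    only under [nu], to choose [k]. *)
Lemma near_integral_le (R : realType) n s
    (h : borel ('rV[R]_n * 'rV[R]_s)%type -> R) (x : 'rV[R]_n)
    (nu : probability (borel 'rV[R]_s) R) :
  measurable_fun setT h -> (forall u, 0 <= h u <= 1) ->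
  {ae nu, forall z,
    {for (x, z), continuous (h : 'rV[R]_n * 'rV[R]_s -> R)}} ->
  forall e : R, 0 < e ->
  \forall y \near nbhs (x, nu : weak_probability R 'rV[R]_s),
    (\int[y.2 : probability (borel 'rV[R]_s) R]_z (h (y.1, z))%:E <=
     \int[nu]_z (h (x, z))%:E + e%:E)%E.
Proof.
move=> mh h01 hae e e0.
pose G (k : nat) : ('rV[R]_n * 'rV[R]_s) -> R := lip_envelope h k%:R.
have k0 (k : nat) : 0 <= k%:R :> R by [].
have G01 k u : 0 <= G k u <= 1 by exact: lip_envelope01.
have cG k y : continuous (fun z : 'rV[R]_s => G k (y, z)).
  move=> z; apply: (@continuous_comp _ _ _ (fun z => (y, z)) (G k)).
    exact: (@cvg_pair _ _ _ (nbhs z) (nbhs y) (nbhs z) _ _ _ (cst y) id (cvg_cst y) cvg_id).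
  exact: lip_envelope_continuous.
have mG k y : measurable_fun setT (fun z : borel 'rV[R]_s => G k (y, z)).
  exact: continuous_measurable_borel.
have mhx y := measurable_section y mh.
(* One third each for the choice of [k], the move from [x] to [y.1], and the move from [nu] to
   [y.2]. *)
have e3 : 0 < e / 3 by rewrite divr_gt0.
have [k Gk] : exists k, (\int[nu]_z (G k (x, z))%:E <=
     \int[nu]_z (h (x, z))%:E + (e / 3)%:E)%E.
  have mGE j : measurable_fun setT (fun z : borel 'rV[R]_s => (G j (x, z))%:E).
    exact/measurable_EFinP.
  have mhE : measurable_fun setT (fun z : borel 'rV[R]_s => (h (x, z))%:E).
    exact/measurable_EFinP.
  have cvG : {ae nu, forall z,
      [set: borel 'rV[R]_s] z ->
      (G j (x, z))%:E @[j --> \oo] --> (h (x, z))%:E}.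
    move: hae; apply: (@filterS _ _ (ae_filter_ringOfSetsType nu)) => z hz _; apply: cvg_EFin; first exact: nearW.
    exact: lip_envelope_cvg.
  have ig : nu.-integrable setT (cst 1%E).
    exact: finite_measure_integrable_cst.
  have dom : {ae nu, forall z j,
      [set: borel 'rV[R]_s] z -> (`|(G j (x, z))%:E| <= cst 1 z)%E}.
    by apply: aeW => z j _; have /andP[? ?] := G01 j (x, z);
      rewrite lee_fin ger0_norm.
  have [ih _] := dominated_convergence measurableT mGE mhE cvG ig dom.
  set I := (\int[_]_z (h _)%:E)%E => cvI.
  have Ifin : I \is a fin_num by exact: integrable_fin_num.
  have : nbhs I [set y | (y < I + (e / 3)%:E)%E].
    apply: open_nbhs_nbhs; split; first exact: open_ereal_lt_ereal.
    by rewrite /= lteDl// lte_fin.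
  by move=> /cvI[N _ HN]; exists N; apply: ltW; exact: HN (leqnn N).
have bG : bounded_fun (fun z => G k (x, z)).
  exists 1; split => // M M1 z _ /=; have /andP[g0 g1] := G01 k (x, z).
  by rewrite ger0_norm// (le_trans g1)// ltW.
pose g : bounded_continuous R 'rV[R]_s := BoundedContinuous (cG k x) bG.
have gE (mu : probability (borel 'rV[R]_s) R) :
    (\int[mu]_z (G k (x, z))%:E = (bc_integral mu g)%:E)%E.
  rewrite /bc_integral /Rintegral fineK//; apply: integrable_fin_num => //.
  apply: measurable_bounded_integrable => //=.
  by rewrite (le_lt_trans (probability_le1 _ _))// ltry.
have cvg_g : bc_integral y.2 g
    @[y --> (x, nu : weak_probability R 'rV[R]_s)] --> bc_integral nu g.
  apply: (@cvg_comp _ _ _ (@snd 'rV[R]_n (weak_probability R 'rV[R]_s))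
    (fun mu => bc_integral mu g) _ (nbhs (nu : weak_probability R 'rV[R]_s))).
    exact: cvg_snd.
  exact: bc_integral_continuous.
near=> y.
have yx : k%:R * `|y.1 - x| <= e / 3.
  apply: (@le_trans _ _ ((k%:R + 1) * `|x - y.1|)).
    by rewrite distrC ler_wpM2r// lerDl.
  rewrite mulrC -ler_pdivlMr ?ltr_wpDl//; apply: ltW; near: y.
  apply: (@cvgr_dist_lt _ _ _ (nbhs (x, nu : weak_probability R 'rV[R]_s)) _ fst x cvg_fst).
  by rewrite divr_gt0// ltr_wpDl.
have gy : bc_integral y.2 g <= bc_integral nu g + e / 3.
  rewrite -lerBlDl (le_trans (ler_norm _))// distrC; apply: ltW; near: y.
  exact: (@cvgr_dist_lt _ _ _ _ _ _ _ cvg_g _ e3).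
apply: (@le_trans _ _ (\int[y.2 : probability (borel 'rV[R]_s) R]_z
    ((G k (x, z))%:E + (e / 3)%:E))%E).
  apply: ge0_le_integral => //.
  - by move=> z _; rewrite lee_fin; case/andP: (h01 (y.1, z)).
  - exact/measurable_EFinP.
  - by apply: emeasurable_funD => //; exact/measurable_EFinP.
  - move=> z _; rewrite -EFinD lee_fin.
    apply: le_trans (lip_envelope_ge h01 (k0 k) (y.1, z)) _.
    apply: le_trans (lip_envelopeD h01 (k0 k) (y.1, z) (x, z)) _.
    (* The product carries the max norm, so the distance of the two points is [|y.1 - x|]. *)
    rewrite lerD2l (_ : (y.1, z) - (x, z) = (y.1 - x, 0)); last first.
      by congr (_, _); rewrite /= subrr.
    by rewrite prod_normE/= normr0 max_l.
rewrite ge0_integralD//; last 3 first.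
- by move=> z _; rewrite lee_fin; case/andP: (G01 k (x, z)).
- exact/measurable_EFinP.
- by move=> z _; rewrite lee_fin ltW.
rewrite integral_cst//.
rewrite [X in (_ * X)%E](probability_setT (y.2 : probability (borel 'rV[R]_s) R)).
rewrite mule1 gE.
apply: (@le_trans _ _ ((bc_integral nu g)%:E + (e / 3)%:E + (e / 3)%:E)%E).
  by rewrite -!EFinD lee_fin lerD2r.
rewrite -gE -addeA; apply: (le_trans (leeD Gk (lexx _))).
rewrite -addeA leeD2l// -!EFinD lee_fin; lra.
Unshelve. all: end_near. Qed.

(** * The discontinuity set and the convergence of the image laws *)

(** The continuity points form a G-delta set: the intersection of the open sets [O k] of points near
    which the oscillation of [f] is below [1 / (k + 1)]. *)
Lemma borel_discontinuity_set (R : realType) (T : topologicalType) (f : T -> R) :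
  <<s @open T >> (discontinuity_set f).
Proof.
pose O k := [set u : T | exists A : set T, [/\ open A, A u &
  forall v w, A v -> A w -> `|f v - f w| < k.+1%:R^-1]].
have -> : discontinuity_set f = \bigcup_k ~` O k.
  rewrite -setC_bigcap -[LHS]setCK; congr (~` _); apply/seteqP; split => u /=.
    move=> /contrapT fu k _.
    have k0 : 0 < k.+1%:R^-1 / 2 :> R by rewrite divr_gt0// invr_gt0.
    have /cvgrPdist_lt/(_ _ k0) := fu.
    rewrite nbhsE => -[A [oA Au] Af]; exists A; split => // v w Av Aw.
    rewrite (le_lt_trans (ler_distD (f u) _ _))// (splitr k.+1%:R^-1).
    by rewrite ltrD//; [rewrite distrC|]; exact: Af.
  move=> Ou; apply; apply/cvgrPdist_lt => e e0.
  have [k ke] := ltr_exists_inv e0.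
  have [A [oA Au Af]] := Ou k I.
  have : nbhs u A by exact: open_nbhs_nbhs.
  by apply: filterS => v Av; apply: lt_trans ke; exact: Af.
apply: sigma_algebra_bigcup => k; rewrite -setTD; apply: sigma_algebraCD.
apply: sub_sigma_algebra; rewrite openE => u [A [oA Au Af]].
by rewrite /interior nbhsE; exists A => // v Av; exists A.
Qed.

(** With a Dirac first factor, the mass of the discontinuity set is the [nu]-mass of its section at
    [x]. *)
Lemma ae_continuous_section (R : realType) n s
    (f : {mfun borel ('rV[R]_n * 'rV[R]_s)%type >-> R}) (x : 'rV[R]_n)
    (nu : probability (borel 'rV[R]_s) R) :
  dirac_prod x nu (discontinuity_set (f : 'rV[R]_n * 'rV[R]_s -> R)) = 0%E ->
  {ae nu, forall z, {for (x, z), continuous (f : 'rV[R]_n * 'rV[R]_s -> R)}}.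
Proof.
set D := discontinuity_set _ => hD.
have mD : @measurable _ (borel ('rV[R]_n * 'rV[R]_s)%type) D.
  exact: borel_discontinuity_set.
pose N : set (borel 'rV[R]_s) := [set z | D (x, z)].
have m1D : measurable_fun [set: borel ('rV[R]_n * 'rV[R]_s)%type] (\1_D : _ -> R).
  exact: measurable_indic.
have mN : measurable N.
  have -> : N = (fun z : borel 'rV[R]_s => \1_D (x, z) : R) @^-1` [set 1].
    apply/seteqP; split => z /=; rewrite indicE; first by move=> Nz; rewrite mem_set.
    by case: (boolP (_ \in _)) => [/set_mem//|_ /eqP]; rewrite eq_sym oner_eq0.
  rewrite -[X in measurable X]setTI.
  exact: (measurable_section x m1D).
exists N; split => //.
have D0 z : 0 <= \1_D z :> R by rewrite indicE.
have := integral_dirac_prod x nu m1D D0.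
rewrite integral_indic// setIT => /(etrans (esym hD)) ->.
have -> : (fun z => (\1_D (x, z) : R)%:E) = (fun z => (\1_N z)%:E).
  by apply/funext => z; rewrite !indicE.
by rewrite integral_indic// setIT.
Qed.

Lemma integral_image_law (R : realType) n s
    (f : {mfun borel ('rV[R]_n * 'rV[R]_s)%type >-> R}) (x : 'rV[R]_n)
    (nu : probability (borel 'rV[R]_s) R) (g : R -> R) :
  measurable_fun setT g -> (forall t, 0 <= g t) ->
  (\int[distribution (dirac_prod x nu) f]_t (g t)%:E =
   \int[nu]_z (g (f (x, z)))%:E)%E.
Proof.
move=> mg g0; rewrite ge0_integral_distribution//; last exact/measurable_EFinP.
by rewrite /comp (integral_dirac_prod x nu (g := g \o f))//;
  [exact: measurableT_comp|move=> z; exact: g0].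
Qed.

Lemma image_lawE (R : realType) n s
    (f : {mfun borel ('rV[R]_n * 'rV[R]_s)%type >-> R}) (x : 'rV[R]_n)
    (nu : probability (borel 'rV[R]_s) R) (A : set R) :
  measurable A ->
  distribution (dirac_prod x nu) f A = (\int[nu]_z (\1_A (f (x, z)) : R)%:E)%E.
Proof.
move=> mA; rewrite -(integral_image_law f x nu (g := \1_A)).
- by rewrite integral_indic// setIT.
- exact: measurable_indic.
- by move=> t; rewrite indicE.
Qed.

(* Interpolating the half-line indicators by [phi] reduces this to the
   one-sided estimate [near_integral_le], applied to [phi \o f] and to
   [1 - phi \o f]. *)
Lemma near_cdf_close (R : realType) n s
    (f : {mfun borel ('rV[R]_n * 'rV[R]_s)%type >-> R}) (x : 'rV[R]_n)
    (nu : probability (borel 'rV[R]_s) R) (a b e : R) :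
  {ae nu, forall z, {for (x, z), continuous (f : 'rV[R]_n * 'rV[R]_s -> R)}} ->
  a < b -> 0 < e ->
  \forall y \near nbhs (x, nu : weak_probability R 'rV[R]_s),
    cdf_close (distribution (dirac_prod x nu) f)
              (distribution (dirac_prod y.1 y.2) f) a b e.
Proof.
move=> fae ab e0.
(* Equal to [1] up to [a], to [0] from [b] on, and affine in between. *)
pose phi (t : R) := Num.min 1 (Num.max 0 ((b - t) / (b - a))).
have ba0 : 0 < b - a by rewrite subr_gt0.
have phi01 t : 0 <= phi t <= 1.
  by rewrite /phi le_min ler01 le_max lexx/= ge_min lexx.
have phia t : t <= a -> phi t = 1.
  move=> ta; rewrite /phi min_l// le_max ler_pdivlMr// mul1r lerD2l lerN2 ta.
  by rewrite orbT.
have phib t : b <= t -> phi t = 0.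
  move=> bt; rewrite /phi max_l ?min_r//.
  by rewrite pmulr_lle0 ?invr_gt0// subr_le0.
have cphi : continuous phi.
  move=> t; apply: (@continuous_min R R (cst 1)
    (fun t => Num.max 0 ((b - t) / (b - a)))); first exact: cvg_cst.
  apply: (@continuous_max R R (cst 0) (fun t => (b - t) / (b - a))); first exact: cvg_cst.
  by apply: cvgM; [apply: cvgB; [exact: cvg_cst|exact: cvg_id]|exact: cvg_cst].
have mphi : measurable_fun setT phi by exact: continuous_measurable_fun.
pose psi t := 1 - phi t.
have cpsi : continuous psi.
  by move=> t; apply: cvgB; [exact: cvg_cst|exact: cphi].
have mpsi : measurable_fun setT psi by exact: continuous_measurable_fun.
have psi01 t : 0 <= psi t <= 1.
  by have /andP[? ?] := phi01 t; rewrite /psi subr_ge0 lerBlDr lerDl; apply/andP.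
have cont (g : R -> R) : continuous g -> {ae nu, forall z,
    {for (x, z), continuous (g \o f : 'rV[R]_n * 'rV[R]_s -> R)}}.
  move=> cg; move: fae; apply: (@filterS _ _ (ae_filter_ringOfSetsType nu)) => z fz.
  by apply: continuous_comp => //; exact: cg.
have near1 := near_integral_le (measurableT_comp mphi (measurable_funP f))
  (fun u => phi01 (f u)) (cont _ cphi) e0.
have near2 := near_integral_le (measurableT_comp mpsi (measurable_funP f))
  (fun u => psi01 (f u)) (cont _ cpsi) e0.
have mfy y := measurable_section y (measurable_funP f).
have le_int (mu : probability (borel 'rV[R]_s) R) y (g h : R -> R) :
    measurable_fun setT g -> measurable_fun setT h ->
    (forall t, 0 <= g t <= h t) ->
    (\int[mu]_z (g (f (y, z)))%:E <= \int[mu]_z (h (f (y, z)))%:E)%E.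
  move=> mg mh gh; apply: ge0_le_integral => //.
  - by move=> z _; rewrite lee_fin; case/andP: (gh (f (y, z))).
  - by apply/measurable_EFinP; exact: (measurableT_comp mg (mfy y)).
  - by apply/measurable_EFinP; exact: (measurableT_comp mh (mfy y)).
  - by move=> z _; rewrite lee_fin; case/andP: (gh (f (y, z))).
have phi_ind t : \1_(`]-oo, a]%classic) t <= phi t <= \1_(`]-oo, b]%classic) t.
  rewrite !indicE !mem_setE !in_itv/=; have /andP[p0 p1] := phi01 t.
  have [ta|ta] := leP t a; first by rewrite phia// (le_trans ta (ltW ab)) /= !lexx.
  by rewrite p0/=; have [//|/ltW bt] := leP t b; rewrite phib.
have psi_ind t : \1_(`]b, +oo[%classic) t <= psi t <= \1_(`]a, +oo[%classic) t.
  rewrite !indicE !mem_setE !in_itv/= !andbT /psi; have /andP[p0 p1] := phi01 t.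
  have [tb|tb] := ltP b t; first by rewrite phib ?(ltW tb)// subr0 (lt_trans ab tb) /= !lexx.
  rewrite subr_ge0 p1/=; have [ta|ta] := ltP a t; first by rewrite lerBlDr lerDl.
  by rewrite phia// subrr.
have m1 (A : set R) : measurable A -> measurable_fun setT (\1_A : R -> R).
  by move=> mA; exact: measurable_indic.
have i0 (A : set R) t : 0 <= \1_A t :> R by rewrite indicE.
move: near1 near2; apply: filterS2 => y h1 h2; split.
- have : (\int[y.2]_z (\1_(`]-oo, a]%classic) (f (y.1, z)) : R)%:E <=
      \int[nu]_z (\1_(`]-oo, b]%classic) (f (x, z)) : R)%:E + e%:E)%E.
    apply: (le_trans (le_int _ _ _ _ (m1 _ _) mphi _)) => //.
      by move=> t; rewrite i0/=; case/andP: (phi_ind t).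
    apply: (le_trans h1); rewrite leeD2r//.
    apply: le_int => //.
    by move=> t; case/andP: (phi_ind t) => _ ->; case/andP: (phi01 t) => ->.
  by rewrite -!image_lawE.
(* The estimate for [psi] compares upper half-lines; passing to complements reverses it into the
   second inequality of [cdf_close]. *)
- have : (\int[y.2]_z (\1_(`]b, +oo[%classic) (f (y.1, z)) : R)%:E <=
      \int[nu]_z (\1_(`]a, +oo[%classic) (f (x, z)) : R)%:E + e%:E)%E.
    apply: (le_trans (le_int _ _ _ _ (m1 _ _) mpsi _)) => //.
      by move=> t; rewrite i0/=; case/andP: (psi_ind t).
    apply: (le_trans h2); rewrite leeD2r//.
    apply: le_int => //.
    by move=> t; case/andP: (psi_ind t) => _ ->; case/andP: (psi01 t) => ->.
  rewrite -!image_lawE//.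
  pose m : probability R R := distribution (dirac_prod x nu) f.
  pose m' : probability R R := distribution (dirac_prod y.1 y.2) f.
  move=> h.
  have mC (m0 : probability R R) t : m0 `]t, +oo[%classic = (1 - m0 `]-oo, t]%classic)%E.
    by rewrite -probability_setC// setCitvl.
  have {}h : (m' `]b, +oo[%classic <=
    m `]a, +oo[%classic + e%:E)%E by exact: h.
  suff : (m `]-oo, a]%classic <= m' `]-oo, b]%classic + e%:E)%E by [].
  move: h; rewrite !mC.
  have : m `]-oo, a]%classic \is a fin_num by exact: fin_num_measure.
  have : m' `]-oo, b]%classic \is a fin_num by exact: fin_num_measure.
  case: (m' _) => [u||]//; case: (m _) => [v||]// _ _ h.
  have {}h : 1 - u <= 1 - v + e := h.
  by rewrite -EFinD lee_fin; lra.
Qed.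

(** * Uniform tails of the image laws *)

Lemma near_uniform_tail (R : realType) (T : ptopologicalType) (N : T -> R)
    (q e : R) (M : set (weak_probability R T)) (nu : weak_probability R T) :
  measurable_fun [set: borel T] N ->
  locally_uniformly_integrating N q M -> M nu -> 0 < e ->
  exists a, 1 <= a /\ \forall mu \near nbhs nu, M mu ->
    (\int[mu : probability (borel T) R]_z
       (N z `^ q * \1_(`]a, +oo[%classic) (N z `^ q))%:E <= e%:E)%E.
Proof.
move=> mN lui Mnu e0.
(* Half of [e], so that the bound on the limit becomes strict and passes to some finite
   threshold. *)
have e20 : 0 < e / 2 by rewrite divr_gt0.
have [L [oL Lnu]] := lui _ _ e20 Mnu.
pose I (a : R) (mu : probability (borel T) R) := (\int[mu]_z
  (N z `^ q * \1_(`]a, +oo[%classic) (N z `^ q))%:E)%E.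
pose S (a : R) := ereal_sup [set I a mu | mu in L `&` M].
rewrite -[X in (X <= _)%E]/(lim (S a @[a --> +oo%R])) => limS.
have mNq : measurable_fun [set: borel T] (fun z => N z `^ q).
  exact: (@measurableT_comp _ _ _ _ _ _ (@powR R ^~ q)).
have mI a : measurable_fun [set: borel T]
    (fun z => (N z `^ q * \1_(`]a, +oo[%classic) (N z `^ q))%:E).
  apply/measurable_EFinP; apply: measurable_funM => //.
  by apply: (@measurableT_comp _ _ _ _ _ _ (\1_(`]a, +oo[%classic) : R -> R)).
have I_ge0 a z : 0 <= N z `^ q * \1_(`]a, +oo[%classic) (N z `^ q) :> R.
  by rewrite mulr_ge0// ?powR_ge0// indicE.
have ubS a mu : L mu -> M mu -> (I a mu <= S a)%E.
  by move=> Lmu Mmu; apply: ereal_sup_ubound; exists mu.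
(* Monotonicity makes the limit exist, so that [lim] is not a default value. *)
have Sni : nonincreasing_fun S.
  move=> b a ba; apply: ge_ereal_sup => _ [mu [Lmu Mmu] <-].
  apply: le_trans (ubS b mu Lmu Mmu); apply: ge0_le_integral => //.
  - by move=> z _; rewrite lee_fin.
  - move=> z _; rewrite lee_fin ler_wpM2l ?powR_ge0// !indicE ler_nat.
    rewrite !mem_setE !in_itv/= !andbT; have [h|//] := ltP a (N z `^ q).
    by rewrite (le_lt_trans ba h).
have cvS := nonincreasing_cvge Sni.
have : (lim (S a @[a --> +oo%R]) < e%:E)%E.
  by apply: (le_lt_trans limS); rewrite lte_fin ltr_pdivrMr// ltr_pMr// ltr1n.
move/cvg_lim : (cvS) => -> // Se.
have near1 : \forall a \near +oo%R, (S a < e%:E)%E.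
  apply: (cvS [set y | (y < e%:E)%E]).
  by apply: open_nbhs_nbhs; split => //; exact: open_ereal_lt_ereal.
(* The bound [1 <= a] lets [near_tail_moment] absorb the constant [1] of the growth condition. *)
have [a [Sa a1]] := filter_ex (filterI near1 (nbhs_pinfty_ge (num_real (1 : R)))).
exists a; split => //.
have : nbhs nu L by exact: open_nbhs_nbhs.
apply: filterS => mu Lmu Mmu; apply: le_trans (ltW Sa); exact: ubS.
Qed.

(** Local boundedness of [eta] provides one bound [C] for all [y] near [x]. Then [K = (2 * C) ^ p]
    works, because [u + 1 <= 2 * max(u, 1)] and [max(u, 1) ^ p <= u ^ p + 1] for [u >= 0]. *)
Lemma limited_by_powR_le (R : realType) n s
    (f : 'rV[R]_n * 'rV[R]_s -> R) (gamma p : R) (x : 'rV[R]_n) :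
  0 <= p -> limited_by gamma f ->
  exists K, 0 < K /\ \forall y \near x, forall z,
    `|f (y, z)| `^ p <= K * (enorm z `^ (gamma * p) + 1).
Proof.
move=> p0 [eta [eta_bnd eta0 feta]].
have near1 := eta_bnd x I.
have [C [C0 etaC]] :=
  filter_ex (filterI (nbhs_pinfty_gt (num_real (0 : R))) near1).
exists ((C * 2) `^ p); split; first by rewrite powR_gt0// mulr_gt0.
have : \forall y \near x, `|eta y| <= C.
  by move: etaC; rewrite /globally/= /within/=; apply: filterS => y /(_ I).
apply: filterS => y yC z.
have e0 : 0 <= enorm z `^ gamma by exact: powR_ge0.
have fC : `|f (y, z)| <= C * 2 * Num.max (enorm z `^ gamma) 1.
  rewrite (le_trans (feta _ _))// -mulrA; apply: ler_pM.
  - exact: ltW.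
  - by rewrite addr_ge0.
  - exact: le_trans (ler_norm _) yC.
  - by rewrite mulr_natl mulr2n lerD// le_max lexx ?orbT.
have max0 : 0 <= Num.max (enorm z `^ gamma) 1 by rewrite le_max e0.
apply: (@le_trans _ _ ((C * 2 * Num.max (enorm z `^ gamma) 1) `^ p)).
  by apply: ge0_ler_powR => //; rewrite nnegrE// !mulr_ge0// ltW.
rewrite powRM// ?mulr_ge0 ?(ltW C0)// ler_wpM2l ?powR_ge0//.
have [_|_] := leP (enorm z `^ gamma) 1; first by rewrite powR1 lerDr powR_ge0.
by rewrite powRrM lerDl.
Qed.

Lemma near_tail_moment (R : realType) n s
    (f : {mfun borel ('rV[R]_n * 'rV[R]_s)%type >-> R}) (gamma p e : R)
    (M : set (weak_probability R 'rV[R]_s)) (x : 'rV[R]_n)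
    (nu : weak_probability R 'rV[R]_s) :
  0 <= p -> limited_by gamma f ->
  locally_uniformly_integrating (@enorm R s) (gamma * p) M -> M nu -> 0 < e ->
  exists b, \forall y \near (x, nu), M y.2 ->
    (tail_moment p b (distribution (dirac_prod y.1 y.2) f) <= e%:E)%E.
Proof.
move=> p0 flim lui Mnu e0.
have [K [K0 nearK]] := limited_by_powR_le x p0 flim.
have e'0 : 0 < e / (2 * K) by rewrite divr_gt0// mulr_gt0.
have [a [a1 neara]] := near_uniform_tail (@measurable_enorm R s) lui Mnu e'0.
(* If [K * (a + 1) < |f| ^ p <= K * (N + 1)], with [N] the power of the norm, then [N > a >= 1],
   whence [|f| ^ p <= 2 * K * N]. The tail is thus at most [2 * K] times that of [N], hence the
   bound [e / (2 * K)]. *)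
exists (K * (a + 1)).
have near1 : \forall y \near (x, nu), forall z,
    `|f (y.1, z)| `^ p <= K * (enorm z `^ (gamma * p) + 1).
  exact: (@cvg_fst 'rV[R]_n (weak_probability R 'rV[R]_s) _ _ _ _ nearK).
have near2 : \forall y \near (x, nu), M y.2 ->
    (\int[y.2 : probability (borel 'rV[R]_s) R]_z (enorm z `^ (gamma * p) *
       \1_(`]a, +oo[%classic) (enorm z `^ (gamma * p)))%:E <= (e / (2 * K))%:E)%E.
  exact: (@cvg_snd 'rV[R]_n (weak_probability R 'rV[R]_s) _ _ _ _ neara).
move: near1 near2; apply: filterS2 => y fK tailN My2.
pose N (z : borel 'rV[R]_s) := enorm z `^ (gamma * p).
have mN : measurable_fun setT N.
  by apply: (@measurableT_comp _ _ _ _ _ _ (@powR R ^~ _)) => //; exact: measurable_enorm.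
rewrite /tail_moment integral_image_law; last 2 first.
- exact: measurable_tail.
- by move=> t; rewrite mulr_ge0// ?powR_ge0// indicE.
have mNt : measurable_fun setT (fun z => N z * \1_(`]a, +oo[%classic) (N z)).
  apply: measurable_funM => //.
  by apply: (@measurableT_comp _ _ _ _ _ _ (\1_(`]a, +oo[%classic) : R -> R)).
have Nt0 z : 0 <= N z * \1_(`]a, +oo[%classic) (N z).
  by rewrite mulr_ge0// ?powR_ge0// indicE.
apply: (@le_trans _ _ (\int[y.2 : probability (borel 'rV[R]_s) R]_z
    ((2 * K)%:E * (N z * \1_(`]a, +oo[%classic) (N z))%:E))%E).
  apply: ge0_le_integral => //.
  - apply/measurable_EFinP.
    apply: (measurableT_comp (measurable_tail p (K * (a + 1)))).
    exact: measurable_section.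
  - by apply: emeasurable_funM => //; exact/measurable_EFinP.
  - move=> z _; rewrite -EFinM lee_fin.
    rewrite indicE mem_setE in_itv/= andbT.
    have [bf|_] := ltP (K * (a + 1)) (`|f (y.1, z)| `^ p); last first.
      by rewrite mulr0 mulr_ge0// mulr_ge0// ltW.
    have := lt_le_trans bf (fK z).
    rewrite ltr_pM2l// ltrD2r => aN.
    rewrite indicE mem_setE in_itv/= andbT aN !mulr1.
    apply: (le_trans (fK z)); rewrite mulrAC [leRHS]mulrC ler_pM2l//.
    rewrite mulr_natl mulr2n lerD2l (le_trans a1)//; exact: ltW.
rewrite ge0_integralZl//; last 3 first.
- exact/measurable_EFinP.
- by move=> z _; rewrite lee_fin.
- by rewrite lee_fin mulr_ge0// ltW.
apply: (@le_trans _ _ ((2 * K)%:E * (e / (2 * K))%:E)%E).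
  rewrite lee_wpmul2l ?lee_fin ?mulr_ge0 ?(ltW K0)//; exact: tailN.
by rewrite -EFinM lee_fin mulrC divfK// mulf_neq0// gt_eqF.
Qed.

(** * From sequences to neighborhoods, and the conclusion *)

(** Were [B] not in [F], every finite intersection of the [A i] would contain a point outside [B];
    along growing intersections these points form a sequence eventually in each [A i] that never
    meets [B]. *)
Lemma filter_countable_seq (I : countType) (X : Type) (F : set_system X)
    (A : I -> set X) (B : set X) : Filter F ->
  (forall i, F (A i)) ->
  (forall u : nat -> X, (forall i, \forall k \near \oo, A i (u k)) ->
    exists k, B (u k)) ->
  F B.
Proof.
move=> FF FA AB; apply: contrapT => nFB.
(* An enumeration of the conditions, with the whole space at numbers that encode no index. *)
pose G j := if unpickle j is Some i then A i else [set: X].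
have FG j : F (G j) by rewrite /G; case: (unpickle j) => //; exact: filterT.
pose V k := [set y | forall j, (j <= k)%N -> G j y].
have FV k : F (V k).
  elim: k => [|k IHk].
    by apply: filterS (FG 0) => y Gy j; rewrite leqn0 => /eqP ->.
  apply: filterS (filterI IHk (FG k.+1)) => y [Vy Gy] j.
  by rewrite leq_eqVlt => /predU1P[->//|]; exact: Vy.
have /choice[u hu] k : exists y, V k y /\ ~ B y.
  apply: contrapT => h; apply: nFB; apply: filterS (FV k) => y Vy.
  by apply: contrapT => nBy; apply: h; exists y.
have [i|k /=] := AB u; last by case: (hu k).
exists (pickle i) => // k /= ik; have [/(_ (pickle i)) + _] := hu k.
by rewrite /G pickleK /=; apply.
Qed.

Theorem theorem1 (R : realType) (p : R) (hp : (1 <= p%:E)%E)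
    (d : measure_display) (T : measurableType d) (P : probability T R)
    (U : {RV P >-> R}) (hU : uniform01 U)
    (rho : LfunType P hp -> R)
    (rho_convex : convex_risk rho)
    (rho_mono : ae_nondecreasing rho)
    (rho_law : law_invariant rho)
    (n s : nat) (f : {mfun borel ('rV[R]_n * 'rV[R]_s)%type >-> R})
    (gamma : R) (gamma_gt0 : 0 < gamma) (f_lim : limited_by gamma f)
    (M : set (weak_probability R 'rV[R]_s))
    (M_moment : M `<=` moment_set (T := borel 'rV[R]_s) (@enorm R s) (gamma * p))
    (M_lui : locally_uniformly_integrating (@enorm R s) (gamma * p) M)
    (x : 'rV[R]_n) (nu : weak_probability R 'rV[R]_s) (M_nu : M nu)
    (hD : dirac_prod x nu
            (discontinuity_set (f : 'rV[R]_n * 'rV[R]_s -> R)) = 0%E) :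
  image_risk rho U f @ within [set y | M y.2] (nbhs (x, nu))
    --> image_risk rho U f (x, nu).
Proof.
have p1 : 1 <= p by rewrite -lee_fin.
have p0 : 0 < p by rewrite (lt_le_trans ltr01).
pose law (y : 'rV[R]_n * weak_probability R 'rV[R]_s) : probability R R :=
  distribution (dirac_prod y.1 y.2) f.
have fae := ae_continuous_section hD.
have j0 (j : nat) : 0 < j.+1%:R^-1 :> R by rewrite invr_gt0.
have /choice[b hb] (j : nat) := near_tail_moment x (ltW p0) f_lim M_lui M_nu (j0 j).
(* The countably many conditions: closeness of distribution functions at rational pairs, small
   tails, and membership in [M]. *)
pose A (i : option (rat * rat * nat + nat)) := match i with
  | None => [set y : 'rV[R]_n * weak_probability R 'rV[R]_s | M y.2]
  | Some (inl (a, a', j)) => [set y | a < a' ->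
      cdf_close (law (x, nu)) (law y) (ratr a) (ratr a') j.+1%:R^-1]
  | Some (inr j) => [set y | (tail_moment p (b j) (law y) <= j.+1%:R^-1%:E)%E]
  end.
pose X y : LfunType P hp := insubd (0 : LfunType P hp) (quantile (law y) \o U).
(* On [M] the moment condition rules out the default value [0] of [insubd]. *)
have XE y : M y.2 -> X y = quantile (law y) \o U :> (T -> R).
  move=> My; rewrite insubdK//; apply: (quantile_Lfun hU p1).
  exact: (image_moment _ gamma_gt0 p1 f_lim (M_moment _ My)).
apply/cvgrPdist_lt => e e0.
apply: (@filter_countable_seq _ _ _ A) => [|u uA].
  move=> [[[[a a'] j]|j]|]; rewrite /A.
  - have [aa'|_] := boolP (a < a'); last by apply: filterE => y.
    have aa'R : ratr a < ratr a' :> R by rewrite ltr_rat.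
    apply: cvg_within; have := near_cdf_close fae aa'R (j0 j).
    by apply: filterS => y hy _.
  - exact: hb.
  - exact: withinT.
have Lp := @quantile_Lp_cvg _ T R P U p (fun k => law (u k)) (law (x, nu)) hU p1.
(* Only one good index is wanted, so a subsequence may be taken. The factor [j.+1%:R ^ (- p)]
   cancels the weight in [convex_monotone_cvg], and [1 / 2 ^ j.+1] makes the series summable. *)
have /choice[m hm] (j : nat) : exists k, M (u k).2 /\
    (\int[P]_w (`|quantile (law (u k)) (U w) - quantile (law (x, nu)) (U w)| `^ p)%:E
     <= (j.+1%:R `^ (- p) * (1 / (2 ^ j.+1)%:R))%:E)%E.
  apply: (@filter_ex _ \oo); apply: filterI; first exact: (uA None).
  apply: Lp.
  - by move=> a a' i aa'; move: (uA (Some (inl (a, a', i)))); apply: filterS => k /(_ aa').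
  - move=> i; exists (b i); split; last exact: (uA (Some (inr i))).
    (* The limit law obeys the same tail bound, since [(x, nu)] lies in each of its
       neighborhoods. *)
    by have /nbhs_singleton/(_ M_nu) := hb i.
  - by rewrite mulr_gt0// ?powR_gt0// divr_gt0// ltr0n expn_gt0.
have [|C hC] := @convex_monotone_cvg _ T R P p hp rho (X (x, nu))
    (fun j => X (u (m j))) rho_convex rho_mono.
  apply: (@le_lt_trans _ _ 1%E); last exact: ltry.
  apply: (le_trans _ (@epsilon_trick0 R 1 xpredT ler01)).
  apply: lee_nneseries => [j _ _|j _].
    by apply: integral_ge0 => w _; rewrite lee_fin powR_ge0.
  have [Mj hj] := hm j.
  under eq_integral do rewrite XE// XE// powRM// EFinM.
  rewrite ge0_integralZl//; last first.
    apply/measurable_EFinP; apply: measurable_normr_powR_comp.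
    by apply: measurable_funB; exact: (measurableT_comp (measurable_quantile _)).
  apply: (@le_trans _ _ ((j.+1%:R `^ p)%:E *
      (j.+1%:R `^ (- p) * (1 / (2 ^ j.+1)%:R))%:E)%E).
    by rewrite lee_wpmul2l// lee_fin powR_ge0.
  rewrite -EFinM lee_fin mulrA -powRD ?subrr ?powRr0 ?mul1r//.
  by rewrite pnatr_eq0 implybT.
have [k Ck] : exists k : nat, k.+1%:R^-1 < e / (`|C| + 1).
  by apply: ltr_exists_inv; rewrite divr_gt0// ltr_wpDl.
exists (m k); rewrite /= distrC.
apply: (le_lt_trans (hC k)).
apply: (@le_lt_trans _ _ ((`|C| + 1) * k.+1%:R^-1)).
  by rewrite ler_wpM2r ?(ltW (j0 k))// (le_trans (ler_norm _))// lerDl.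
by rewrite mulrC -ltr_pdivlMr// ltr_wpDl.
Qed.
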